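(* Let $A$ be a nonempty set (of parameters), let $X$ be a nonempty set, and let $F,H:A\to\mathcal P(X)$ be soft sets with $F(t)\neq\varnothing$ and $H(t)\neq\varnothing$ for all $t\in A$. Then $$\mathrm{SE}(F)\cup \mathrm{SE}(H)\subseteq \mathrm{SE}(F\cup_s H)=\prod_{t\in A}(F(t)\cup H(t)).$$ Moreover, the inclusion is strict if and only if there exist distinct parameters $s,t\in A$ such that $H(s)\setminus F(s)\neq\varnothing$ and $F(t)\setminus H(t)\neq\varnothing$. Equivalently, equality holds in exactly the following cases: (i) $H(t)\subseteq F(t)$ for every $t\in A$; (ii) $F(t)\subseteq H(t)$ for every $t\in A$; (iii) all strict differences in the two directions occur at one and the same parameter, i.e. there is $t_0\in A$ such that $\{t\in A: H(t)\setminus F(t)\neq\varnothing\}\cup\{t\in A: F(t)\setminus H(t)\neq\varnothing\}\subseteq\{t_0\}$. In particular, if there are two different parameters $s\neq t$ with $H(s)\setminus F(s)\neq\varnothing$ and $F(t)\setminus H(t)\neq\varnothing$, then $\mathrm{SE}(F\cup_s H)$ contains selectors not lying in $\mathrm{SE}(F)\cup\mathrm{SE}(H)$.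
   Context: A soft set over $X$ with parameter set $A$ is a map $F:A\to\mathcal P(X)$ (the sets $F(t)$ are its sections). A soft element (selector) of $F$ is a function $a:A\to X$ with $a(t)\in F(t)$ for all $t\in A$; $\mathrm{SE}(F)=\prod_{t\in A}F(t)$ denotes the set of all soft elements of $F$. The soft union is defined by $(F\cup_s H)(t)=F(t)\cup H(t)$ for $t\in A$. The axiom of choice is assumed. *)

(* Defs.v *)
From mathcomp Require Import all_boot.
From mathcomp Require Import boolp classical_sets.

Set Implicit Arguments.
Unset Strict Implicit.
Unset Printing Implicit Defensive.

Local Open Scope classical_set_scope.

Definition soft_set (A X : Type) : Type := A -> set X.

Definition soft_element (A X : Type) (F : soft_set A X) (a : A -> X) : Prop :=
  forall t : A, F t (a t).

Definition SE (A X : Type) (F : soft_set A X) : set (A -> X) :=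
  [set a | soft_element F a].

Definition soft_union (A X : Type) (F H : soft_set A X) : soft_set A X :=
  fun t => F t `|` H t.

(* Main.v *)
Require Import Defs.
From mathcomp Require Import all_boot.
From mathcomp Require Import boolp classical_sets.

Local Open Scope classical_set_scope.

Set Implicit Arguments.
Unset Strict Implicit.

Section CrossingDifferences.

Context {A X : Type}.
Implicit Types F H : soft_set A X.

(** A selector of the union escapes both [SE F] and [SE H] exactly when it leaves [F] at some
    parameter and [H] at another, so the inclusion is strict exactly when differences in opposite
    directions occur at two distinct parameters. [mixed_selector] builds such a selector,
    [selector_crossing] reads the parameters off one, and [not_crossing_differences] sorts the
    remaining situations into the three cases. *)

Definition crossing_differences F H : Prop :=
  exists s t : A, [/\ s <> t, H s `\` F s !=set0 & F t `\` H t !=set0].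

Lemma subSE_soft_union F H : SE F `|` SE H `<=` SE (soft_union F H).
Proof. by move=> a [] ha t; [left|right]; apply: ha. Qed.

(** Take a choice function [g] for [F] and overwrite it at two points: the value at [s] expels it
    from [SE F], the value at [t] from [SE H]. *)
Lemma mixed_selector F H (s t : A) : (forall u : A, F u !=set0) ->
  s <> t -> H s `\` F s !=set0 -> F t `\` H t !=set0 ->
  exists a : A -> X, SE (soft_union F H) a /\ ~ (SE F `|` SE H) a.
Proof.
move=> /choice[g gF] neq_st [x [Hx nFx]] [y [Fy nHy]].
pose a u := if `[< u = s >] then x else if `[< u = t >] then y else g u.
have as_ : a s = x by rewrite /a asboolT.
(* The test for [s] comes first, so distinctness is what lets the value [y] survive at [t]. *)
have at_ : a t = y by rewrite /a asboolF ?asboolT// => /esym.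
exists a; split.
  move=> u; rewrite /a; case: asboolP => [->|_]; first by right.
  by case: asboolP => [->|_]; left.
by case=> [/(_ s)|/(_ t)]; rewrite ?as_ ?at_.
Qed.

(* The two witnessing parameters differ because [a s] lies in [H s] but not
   in [F s], whereas [a t] lies in [F t] but not in [H t]. *)
Lemma selector_crossing F H (a : A -> X) :
  SE (soft_union F H) a -> ~ (SE F `|` SE H) a -> crossing_differences F H.
Proof.
move=> aFH /not_orP[/existsNP[s nFs] /existsNP[t nHt]].
have Hs : H s (a s) by case: (aFH s).
have Ft : F t (a t) by case: (aFH t).
exists s, t; split; [|by exists (a s)|by exists (a t)].
by move=> st; apply: nFs; rewrite st.
Qed.

(** As the direct inclusion always holds, both strictness and equality are decided by this reverse
    one. *)
Lemma SE_soft_union_sub F H : (forall u : A, F u !=set0) ->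
  SE (soft_union F H) `<=` SE F `|` SE H <-> ~ crossing_differences F H.
Proof.
move=> hF; split=> [sub [s [t [st Hs Ft]]]|ncross a aFH].
  by have [a [/sub]] := mixed_selector hF st Hs Ft.
by apply: contrapT => /(selector_crossing aFH).
Qed.

(** Without a crossing, every parameter of one difference set equals every parameter of the other.
    Hence either one of these sets is empty, or both are the same singleton. *)
Lemma not_crossing_differences F H : ~ crossing_differences F H <->
  [\/ forall t : A, H t `<=` F t,
      forall t : A, F t `<=` H t
    | exists t0 : A,
        [set t | H t `\` F t !=set0] `|` [set t | F t `\` H t !=set0]
          `<=` [set t0]].
Proof.
split=> [ncross|cases [s [t [st Hs Ft]]]]; last first.
  case: cases => [sub|sub|[t0 sub]].
  - by have [x [/sub]] := Hs.
  - by have [x [/sub]] := Ft.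
  - by apply: st; rewrite (sub s (or_introl Hs)) (sub t (or_intror Ft)).
have same s t : H s `\` F s !=set0 -> F t `\` H t !=set0 -> s = t.
  by move=> Hs Ft; apply: contrapT => st; apply: ncross; exists s, t.
have [subHF|/existsNP[s nsubHF]] := pselect (forall t, H t `<=` F t).
  exact: Or31.
have [subFH|/existsNP[t nsubFH]] := pselect (forall t, F t `<=` H t).
  exact: Or32.
have Hs := nonsubset nsubHF; have Ft := nonsubset nsubFH.
apply: Or33; exists t => u [Hu|Fu] /=; first exact: same.
(* Here [u] and [t] lie in the same difference set; they are compared through [s], which lies in the
   other. *)
by rewrite -(same s u Hs Fu); apply: same.
Qed.

End CrossingDifferences.

Theorem theorem2p5 (A X : Type) (F H : soft_set A X)
    (hA : [set: A] !=set0) (hX : [set: X] !=set0)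
    (hF : forall t : A, F t !=set0) (hH : forall t : A, H t !=set0) :
  [/\ SE F `|` SE H `<=` SE (soft_union F H),
      SE (soft_union F H) = [set a : A -> X | forall t : A, (F t `|` H t) (a t)],
      SE F `|` SE H `<` SE (soft_union F H) <->
        (exists s t : A, [/\ s <> t, H s `\` F s !=set0 & F t `\` H t !=set0]),
      SE F `|` SE H = SE (soft_union F H) <->
        [\/ forall t : A, H t `<=` F t,
            forall t : A, F t `<=` H t
          | exists t0 : A,
              [set t | H t `\` F t !=set0] `|` [set t | F t `\` H t !=set0]
                `<=` [set t0]]
    & forall s t : A, s <> t -> H s `\` F s !=set0 -> F t `\` H t !=set0 ->
        exists a : A -> X,
          SE (soft_union F H) a /\ ~ (SE F `|` SE H) a].
Proof.
have sub := @subSE_soft_union _ _ F H.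
have subE := @SE_soft_union_sub _ _ F H hF.
split=> //.
(* [proper] negates the reverse inclusion, so [subE] leaves a doubly negated crossing. *)
- rewrite /proper subE; split=> [[_ /contrapT //]|cross].
  by split=> // ncross.
- rewrite -not_crossing_differences -subE; split=> [->//|sub'].
  exact/seteqP.
- by move=> s t; apply: mixed_selector.
Qed.
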